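(* The Birkhoff-type algorithm in which permutations are selected by the Frank-Wolfe update over all permutation matrices may fail to converge. Precisely: for every $\epsilon>0$ there exist $n$, a (vectorized) $n\times n$ doubly stochastic matrix $x^\star\in\mathcal B$, and a sequence of iterates $x_0=0,x_1,x_2,\dots$ generated by $$p_k\in\arg\min_{u\in\mathcal P}\;-(x^\star-x_{k-1})^Tu,\qquad \theta_k=\min_{j}\{(x^\star(j)-x_{k-1}(j)-1)p_k(j)+1\},\qquad x_k=x_{k-1}+\theta_kp_k,$$ such that there is no integer $k\ge0$ with $\|x_k-x^\star\|_2^2\le\epsilon$.
   Context: Let $d=n^2$. $n\times n$ matrices are identified with vectors in $\mathbb R^d$ by stacking columns; $x(j)$ is the $j$-th component of $x$. $\mathcal B\subset\mathbb R^d$ is the set of vectorized doubly stochastic matrices (nonnegative entries, all row and column sums equal to $1$), and $\mathcal P\subset\{0,1\}^d$ is the set of vectorized permutation matrices (the extreme points of $\mathcal B$). The selection of $p_k$ is the linear program of minimizing $-(x^\star-x_{k-1})^Tu$ over $u\in\mathcal B$, whose returned solution is always an extreme point of $\mathcal B$. The step size $\theta_k$ is the largest value keeping $x_k\le x^\star$ componentwise on the support of $p_k$. *)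

(* Defs.v *)
From mathcomp Require Import all_boot all_order all_algebra.
From mathcomp Require Import classical_sets reals.

Set Implicit Arguments.
Unset Strict Implicit.
Unset Printing Implicit Defensive.

Import Order.TTheory GRing.Theory Num.Theory.
Local Open Scope ring_scope.
Local Open Scope classical_set_scope.

(* MathComp's [mxvec] concatenates rows; stacking the columns of [A] means
   concatenating the rows of [A^T]. *)
Definition vec (R : realType) (n : nat) (A : 'M[R]_n) : 'cV[R]_(n * n) :=
  (mxvec A^T)^T.

Definition doubly_stochastic (R : realType) (n : nat) (A : 'M[R]_n) : Prop :=
  [/\ forall i j, 0 <= A i j,
      forall i, \sum_j A i j = 1 &
      forall j, \sum_i A i j = 1].

Definition birkhoff (R : realType) (n : nat) : set 'cV[R]_(n * n) :=
  [set vec A | A in [set A : 'M[R]_n | doubly_stochastic A]].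

Definition perm_vecs (R : realType) (n : nat) : set 'cV[R]_(n * n) :=
  [set vec A | A in [set A : 'M[R]_n | is_perm_mx A]].

Arguments birkhoff : clear implicits.
Arguments perm_vecs : clear implicits.

Definition argmin (R : realType) (T : Type) (S : set T) (f : T -> R) : set T :=
  [set u | S u /\ forall v, S v -> f u <= f v].

Definition dotv (R : realType) (d : nat) (u v : 'cV[R]_d) : R :=
  (u^T *m v) 0 0.

(* The default norm on matrices in MathComp-Analysis is the max norm. *)
Definition norm2 (R : realType) (d : nat) (v : 'cV[R]_d) : R :=
  Num.sqrt (\sum_j v j 0 ^+ 2).

(* The minimum must be attained, so no [m] qualifies when [d = 0]. *)
Definition is_min (R : realType) (d : nat) (F : 'I_d -> R) (m : R) : Prop :=
  (exists j, F j = m) /\ (forall j, m <= F j).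

(* [p 0] and [theta 0] are unconstrained and play no role. *)
Definition fw_birkhoff_run (R : realType) (n : nat) (xstar : 'cV[R]_(n * n))
    (x p : nat -> 'cV[R]_(n * n)) (theta : nat -> R) : Prop :=
  x 0%N = 0 /\
  forall k : nat,
    [/\ argmin (perm_vecs R n) (fun u => - dotv (xstar - x k) u) (p k.+1),
        is_min (fun j => (xstar j 0 - x k j 0 - 1) * p k.+1 j 0 + 1)
               (theta k.+1) &
        x k.+1 = x k + theta k.+1 *: p k.+1].

(* Main.v *)
Require Import Defs.
From mathcomp Require Import all_boot all_order all_algebra.
From mathcomp Require Import classical_sets reals.
From mathcomp Require Import perm.
From mathcomp Require Import ring lra.

Set Implicit Arguments.
Unset Strict Implicit.
Unset Printing Implicit Defensive.

Import Order.TTheory GRing.Theory Num.Theory.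
Local Open Scope ring_scope.

(** The algorithm stalls as soon as a maximum-weight permutation uses a zero
    entry of the residual: the step is then [0], the residual is unchanged, and
    the same permutation may be selected for ever. This can already happen at
    the first step. If [A i j <= (A i i + A j j) / 2] for all [i] and [j], then
    summing over the graph of any permutation shows that its weight is at most
    the trace of [A], so that the identity is a legitimate choice; if
    moreover [A] has a zero on its diagonal, then all the iterates are [0]
    ([run_stuck_at_zero]).

    A doubly stochastic matrix of this kind is the arrow matrix of order [m + 1]
    with diagonal [1 - 1/m, ..., 1 - 1/m, 0], whose last row and last column
    contain [1/m] outside the corner, and which is zero elsewhere. The midpoint
    inequality amounts to [1/m <= (1 - 1/m) / 2], that is, [3 <= m]. The squared
    norm of this matrix is at least [m (1 - 1/m)^2 > m - 2], which exceeds any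
    prescribed [epsilon] for large [m]. *)

(** The column index comes first because columns are stacked. *)
Lemma vecE (R : realType) n (A : 'M[R]_n) i j :
  vec A (mxvec_index j i) 0 = A i j.
Proof. by rewrite /vec mxE mxvecE mxE. Qed.

Lemma sum_mxvec_index (R : realType) n (F : 'I_(n * n) -> R) :
  \sum_k F k = \sum_i \sum_j F (mxvec_index j i).
Proof.
rewrite (reindex _ (curry_mxvec_bij _ _)) /= exchange_big /=.
rewrite pair_bigA /=.
by apply: eq_bigr => -[].
Qed.

Lemma dotv_vec (R : realType) n (A B : 'M[R]_n) :
  dotv (vec A) (vec B) = \sum_i \sum_j A i j * B i j.
Proof.
rewrite /dotv mxE sum_mxvec_index.
by apply: eq_bigr => i _; apply: eq_bigr => j _; rewrite [_^T _ _]mxE !vecE.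
Qed.

Lemma dotv_vec_perm (R : realType) n (A : 'M[R]_n) (s : 'S_n) :
  dotv (vec A) (vec (perm_mx s)) = \sum_i A i (s i).
Proof.
rewrite dotv_vec; apply: eq_bigr => i _.
rewrite (bigD1 (s i)) //= big1 => [|j js].
  by rewrite !mxE eqxx mulr1 addr0.
by rewrite !mxE eq_sym (negbTE js) mulr0.
Qed.

Lemma norm2_vec_sqr (R : realType) n (A : 'M[R]_n) :
  norm2 (vec A) ^+ 2 = \sum_i \sum_j A i j ^+ 2.
Proof.
rewrite /norm2 sqr_sqrtr; last by apply: sumr_ge0 => k _; apply: sqr_ge0.
rewrite sum_mxvec_index.
by apply: eq_bigr => i _; apply: eq_bigr => j _; rewrite vecE.
Qed.

(** The numbers [A i i / 2], used as row and as column prices, form a dual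
    certificate for the assignment problem: each price is paid once by a row
    and once by a column, whence the trace. *)
Lemma perm_weight_le_trace (R : realType) n (A : 'M[R]_n) (s : 'S_n) :
  (forall i j, A i j <= (A i i + A j j) / 2) ->
  \sum_i A i (s i) <= \tr A.
Proof.
move=> midA.
apply: (le_trans (ler_sum _ (fun i _ => midA i (s i)))).
rewrite -mulr_suml big_split /=.
rewrite -(reindex_inj (P := xpredT) (F := fun i => A i i) (@perm_inj _ s)) /=.
rewrite -/(\tr A); lra.
Qed.

(** The run is constant: the identity is optimal for the residual [A], and
    the zero at [(i0, i0)] forces a zero step, which leaves the residual [A]. *)
Lemma run_stuck_at_zero (R : realType) n (A : 'M[R]_n) (i0 : 'I_n) :
  (forall i j, 0 <= A i j) ->
  (forall i j, A i j <= (A i i + A j j) / 2) ->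
  A i0 i0 = 0 ->
  fw_birkhoff_run (vec A) (fun=> 0) (fun=> vec 1%:M) (fun=> 0).
Proof.
move=> A0 midA Ai0; split=> // k; split; last by rewrite scale0r addr0.
- rewrite -perm_mx1 subr0; split.
    by exists (perm_mx 1); first exact: perm_mx_is_perm.
  move=> _ [_ /is_perm_mxP[s ->] <-]; rewrite lerN2 !dotv_vec_perm.
  under [leRHS]eq_bigr do rewrite perm1.
  exact: perm_weight_le_trace.
split.
  (* This entry is used by the identity and its residual is zero. *)
  exists (mxvec_index i0 i0).
  by rewrite !vecE !mxE eqxx Ai0 subr0 sub0r mulr1 addNr.
move=> l; case/mxvec_indexP: l => j i; rewrite !vecE !mxE subr0.
by case: (i == j); rewrite /= ?mulr1 ?subrK ?mulr0 ?add0r.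
Qed.

Definition arrow (R : realType) (m : nat) : 'M[R]_(m + 1) :=
  block_mx (1 - m%:R^-1)%:M (const_mx m%:R^-1) (const_mx m%:R^-1) 0.

Lemma trmx_arrow (R : realType) m : (arrow R m)^T = arrow R m.
Proof. by rewrite /arrow tr_block_mx tr_scalar_mx !trmx_const. Qed.

Lemma arrow_ge0 (R : realType) m i j : 0 <= arrow R m i j.
Proof.
have m1 : m%:R^-1 <= 1 :> R.
  by case: m {i j} => [|m]; rewrite ?invr0 ?ler01 // invf_le1 ?ler1n ?ltr0n.
rewrite /arrow; case: (split_ordP i) => i' ->; case: (split_ordP j) => j' ->.
- by rewrite block_mxEul mxE mulrn_wge0 // subr_ge0.
- by rewrite block_mxEur mxE invr_ge0 ler0n.
- by rewrite block_mxEdl mxE invr_ge0 ler0n.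
- by rewrite block_mxEdr mxE.
Qed.

Lemma arrow_row_sum (R : realType) m i :
  (0 < m)%N -> \sum_j arrow R m i j = 1.
Proof.
move=> m0; rewrite /arrow big_split_ord /= big_ord1.
case: (split_ordP i) => i' ->.
  rewrite block_mxEur mxE (bigD1 i') //= big1 => [|j ji].
    by rewrite block_mxEul mxE eqxx mulr1n addr0 subrK.
  by rewrite block_mxEul mxE eq_sym (negbTE ji).
rewrite block_mxEdr mxE addr0.
under eq_bigr do rewrite block_mxEdl mxE.
by rewrite sumr_const card_ord -[LHS]mulr_natl mulfV // pnatr_eq0 -lt0n.
Qed.

Lemma arrow_doubly_stochastic (R : realType) m :
  (0 < m)%N -> doubly_stochastic (arrow R m).
Proof.
move=> m0; split=> [||j]; [exact: arrow_ge0|by move=> i; apply: arrow_row_sum|].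
rewrite -(arrow_row_sum R j m0) -[in LHS]trmx_arrow.
by apply: eq_bigr => i _; rewrite mxE.
Qed.

Lemma arrow_le_midpoint (R : realType) m i j : (3 <= m)%N ->
  arrow R m i j <= (arrow R m i i + arrow R m j j) / 2.
Proof.
move=> m3.
have m0 : 0 < m%:R :> R by rewrite ltr0n (leq_trans _ m3).
have V3 : m%:R^-1 * 3 <= 1 :> R.
  by rewrite mulrC ler_pdivrMr // mul1r ler_nat.
rewrite /arrow; case: (split_ordP i) => i' ->; case: (split_ordP j) => j' ->;
  rewrite ?(block_mxEul, block_mxEur, block_mxEdl, block_mxEdr) !mxE ?eqxx.
- by case: eqP; rewrite /= ?mulr1n ?mulr0n; lra.
- by rewrite mulr1n; lra.
- by rewrite mulr1n; lra.
- by lra.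
Qed.

(** Already the diagonal contributes [m (1 - 1/m)^2 = m - 2 + 1/m]. *)
Lemma norm2_arrow (R : realType) m :
  (0 < m)%N -> m%:R - 2 < norm2 (vec (arrow R m)) ^+ 2.
Proof.
move=> m0; rewrite norm2_vec_sqr.
have m0R : 0 < m%:R :> R by rewrite ltr0n.
have diag : m%:R * (1 - m%:R^-1) ^+ 2
            <= \sum_i \sum_j arrow R m i j ^+ 2.
  apply: (@le_trans _ _ (\sum_i arrow R m i i ^+ 2)).
    rewrite big_split_ord /= big_ord1 /arrow block_mxEdr mxE expr0n addr0.
    under eq_bigr do rewrite block_mxEul mxE eqxx mulr1n.
    by rewrite sumr_const card_ord mulr_natl.
  apply: ler_sum => i _; rewrite (bigD1 i) //= lerDl.
  by apply: sumr_ge0 => j _; apply: sqr_ge0.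
apply: lt_le_trans diag.
have -> : m%:R * (1 - m%:R^-1) ^+ 2 = m%:R - 2 + m%:R^-1 :> R.
  by field; rewrite gt_eqF.
by rewrite ltrDl invr_gt0.
Qed.

Theorem theorem4 (R : realType) (epsilon : R) (heps : 0 < epsilon) :
  exists (n : nat) (xstar : 'cV[R]_(n * n)),
    birkhoff R n xstar /\
    exists (x p : nat -> 'cV[R]_(n * n)) (theta : nat -> R),
      fw_birkhoff_run xstar x p theta /\
      ~ (exists k : nat, norm2 (x k - xstar) ^+ 2 <= epsilon).
Proof.
(* At least 3 for the midpoint inequality, and such that [m - 2] is the
   successor of the integral part of [epsilon]. *)
pose m := (Num.truncn epsilon).+3.
exists (m + 1)%N, (vec (arrow R m)); split.
  by exists (arrow R m) => //; apply: arrow_doubly_stochastic.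
exists (fun=> 0), (fun=> vec 1%:M), (fun=> 0); split.
  apply: (run_stuck_at_zero (i0 := rshift m 0)).
  - exact: arrow_ge0.
  - by move=> i j; apply: arrow_le_midpoint.
  - by rewrite /arrow block_mxEdr mxE.
move=> [_]; apply/negP; rewrite -ltNge.
have -> : norm2 (0 - vec (arrow R m)) = norm2 (vec (arrow R m)).
  by congr Num.sqrt; apply: eq_bigr => l _; rewrite sub0r mxE sqrrN.
apply: (le_lt_trans _ (norm2_arrow R _)) => //.
have := truncnS_gt epsilon.
by rewrite /m -[X in X%:R - 2]addn2 natrD addrK => /ltW.
Qed.
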